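(* Let $X_{\lambda_1},X_{\lambda}$ be independent random variables with $X_{\lambda_1}\sim W(\alpha,\lambda_1)$ and $X_{\lambda}\sim W(\alpha,\lambda)$, where $\lambda_1,\lambda>0$. Let $Y_{\lambda_1^{*}},Y_{\lambda}$ be independent random variables with $Y_{\lambda_1^{*}}\sim W(\alpha,\lambda_1^{*})$ and $Y_{\lambda}\sim W(\alpha,\lambda)$, where $\lambda_1^{*},\lambda>0$. Let $X_{2:2}=\max(X_{\lambda_1},X_{\lambda})$ and $Y_{2:2}=\max(Y_{\lambda_1^{*}},Y_{\lambda})$. Suppose $\lambda_1^{*}=\min(\lambda,\lambda_1,\lambda_1^{*})$. Then, for any $\alpha>0$, $$(\lambda_1,\lambda)\preceq^{w}(\lambda_1^{*},\lambda)\ \Rightarrow\ X_{2:2}\le_{lr}Y_{2:2}.$$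
   Context: Weibull distribution: $X\sim W(\alpha,\lambda)$ (shape $\alpha>0$, parameter $\lambda>0$) means $X$ has density $f(t)=\alpha\lambda(\lambda t)^{\alpha-1}e^{-(\lambda t)^{\alpha}}$ for $t>0$, i.e. distribution function $1-e^{-(\lambda t)^{\alpha}}$ for $t>0$. ''Increasing'' means non-decreasing. Weak majorization: for $x,y\in\mathbb{R}^n$ with increasing arrangements $x_{(1)}\le\cdots\le x_{(n)}$ and $y_{(1)}\le\cdots\le y_{(n)}$, $x\preceq^{w}y$ means $\sum_{i=1}^{j}x_{(i)}\ge\sum_{i=1}^{j}y_{(i)}$ for all $j=1,\ldots,n$. Likelihood ratio order: for random variables $X,Y$ with densities $f,g$, $X\le_{lr}Y$ means that $g(t)/f(t)$ is increasing in $t$ over all $t$ for which the ratio is well defined (here, $t>0$). *)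

(* Defs.v *)
From HB Require Import structures.
From mathcomp Require Import all_boot all_order all_algebra.
From mathcomp Require Import all_classical all_reals all_analysis.
Set Implicit Arguments.
Unset Strict Implicit.
Unset Printing Implicit Defensive.
Import Order.TTheory GRing.Theory Num.Theory.

Local Open Scope classical_set_scope.
Local Open Scope ring_scope.

Definition has_density (R : realType) (d : measure_display)
    (T : measurableType d) (P : probability T R) (X : {RV P >-> R})
    (f : R -> R) : Prop :=
  [/\ measurable_fun setT f,
      (forall t, 0 <= f t) &
      (forall A : set R, measurable A ->
        distribution P X A = (\int[lebesgue_measure]_(t in A) (f t)%:E)%E)].

Definition indep_RV (R : realType) (d : measure_display)
    (T : measurableType d) (P : probability T R) (X Y : {RV P >-> R}) : Prop :=
  forall A B : set R, measurable A -> measurable B ->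
    P (X @^-1` A `&` Y @^-1` B) = (P (X @^-1` A) * P (Y @^-1` B))%E.

Definition weibull_pdf (R : realType) (alpha lambda : R) (t : R) : R :=
  if 0 < t then
    alpha * lambda * (lambda * t) `^ (alpha - 1) * expR (- (lambda * t) `^ alpha)
  else 0.

Definition weibull (R : realType) (d : measure_display)
    (T : measurableType d) (P : probability T R) (X : {RV P >-> R})
    (alpha lambda : R) : Prop :=
  has_density X (weibull_pdf alpha lambda).

(* [weak_maj x y] is x <=^w y; [sort] gives the increasing arrangement. *)
Definition weak_maj (R : realType) (n : nat) (x y : n.-tuple R) : Prop :=
  forall j : nat, (1 <= j <= n)%N ->
    \sum_(0 <= i < j) (sort <=%R y)`_i <= \sum_(0 <= i < j) (sort <=%R x)`_i.

(* The likelihood ratio order X <=_lr Y. Densities are determined only almost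
   everywhere, hence the existential over versions. The ratio is taken in
   \bar R, where a / 0 = +oo for a > 0; it is ill-defined only where both
   densities vanish (the library would set 0 / 0 = 0). *)
Definition lr_le (R : realType)
    (d : measure_display) (T : measurableType d) (P : probability T R)
    (d' : measure_display) (T' : measurableType d') (Q : probability T' R)
    (X : {RV P >-> R}) (Y : {RV Q >-> R}) : Prop :=
  exists f g : R -> R,
    [/\ has_density X f,
        has_density Y g &
        {in [pred t | (f t != 0) || (g t != 0)] &,
          {homo (fun t => ((g t)%:E / (f t)%:E)%E) : s t / s <= t >->
            (s <= t)%E}}].

(* Main.v *)
(**
Writing [S_a u] for the integral of [expR (a s)] over [0, u] and [u = t `^ alpha],
the density of the maximum of W(alpha, lambda) and W(alpha, mu) is, up to a
factor depending only on [t] and [alpha],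
  [a b expR (- (a + b) u) (S_a u + S_b u)], a = lambda `^ alpha, b = mu `^ alpha.
Hence the ratio of the two densities is, up to a constant,
  [expR ((a - c) u) (S_c u + S_b u) / (S_a u + S_b u)], c = lambda1s `^ alpha.
By [a S_a u = expR (a u) - 1], its derivative has the sign of
  [(S_a + S_b) (2 + (b - c) S_b) - (S_c + S_b) (2 + (b - a) S_b)],
which is nonnegative since [c <= a], [c <= b] and [S_c <= S_a].
The density of the maximum is obtained from its survival function on the rays
[[x, +oo[] with [x > 0] only, which avoids the singularity at 0 when [alpha < 1].
*)
Require Import Defs.
From HB Require Import structures.
From mathcomp Require Import all_boot all_order all_algebra.
From mathcomp Require Import all_classical all_reals all_analysis.
From mathcomp Require Import measurable_realfun ring.
Import Order.TTheory GRing.Theory Num.Theory.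
Import numFieldNormedType.Exports.
Local Open Scope classical_set_scope.
Local Open Scope ring_scope.

(** * Measures and densities determined on positive rays *)

(** The rays [[1/(n+1), +oo[] increase to []0, +oo[], and a ray starting at [x <= 0] has the measure
    of []0, +oo[], because []-oo, 0]] is null. So the measures agree on all closed rays, a
    generating family of the Borel sets that is stable under intersection. *)
Lemma measure_unique_positive_rays (R : realType)
    (m1 m2 : {measure set R -> \bar R}) :
  m1 `]-oo, 0]%classic = 0%E -> m2 `]-oo, 0]%classic = 0%E ->
  (forall x : R, 0 < x -> m1 `[x, +oo[%classic = m2 `[x, +oo[%classic) ->
  (m1 setT < +oo)%E ->
  forall A, measurable A -> m1 A = m2 A.
Proof.
move=> m10 m20 m12 m1oo.
have m12_0y : m1 `]0, +oo[%classic = m2 `]0, +oo[%classic.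
  have cvgm (m : {measure set R -> \bar R}) :
      m `[n.+1%:R^-1, +oo[%classic @[n --> \oo] --> m `]0, +oo[%classic.
    have := @nondecreasing_cvg_mu _ _ _ m (fun n => `[n.+1%:R^-1, +oo[%classic).
    have -> : `]0, +oo[%classic = \bigcup_n `[n.+1%:R^-1, +oo[%classic :> set R.
      by rewrite itvoyEbigcup; apply: eq_bigcupr => n _; rewrite add0r.
    apply=> [n||n k nk].
    - exact: measurable_itv.
    - by apply: bigcup_measurable => n _; exact: measurable_itv.
    - apply/subsetPset/subset_itvr; rewrite bnd_simp.
      by rewrite lef_pV2 ?posrE ?ler_nat.
  rewrite -(cvg_lim (@ereal_hausdorff R) (cvgm m1)).
  rewrite -(cvg_lim (@ereal_hausdorff R) (cvgm m2)).
  by under eq_fun do rewrite m12 ?invr_gt0//.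
have m_ray (m : {measure set R -> \bar R}) (x : R) : m `]-oo, 0]%classic = 0%E ->
    x <= 0 -> m `[x, +oo[%classic = m `]0, +oo[%classic.
  move=> m0 x0.
  rewrite (@itv_bndbnd_setU _ _ (BLeft x) (BRight 0) +oo%O) ?bnd_simp//.
  rewrite measureU//=; last first.
    rewrite -subset0 => y [] /=; rewrite !in_itv/= => /andP[_ y0].
    by rewrite andbT ltNge y0.
  rewrite (_ : m `[x, 0]%classic = 0%E) ?add0e//.
  apply: (subset_measure0 _ _ _ m0) => //.
  exact: subset_itvr.
move=> A mA.
apply: (measure_unique (@RGenCInfty.G R) (fun n => `[- n%:R, +oo[%classic)).
- exact: RGenCInfty.measurableE.
- move=> _ _ [x ->] [y ->]; exists (Num.max x y); apply/seteqP; split => z /=;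
    rewrite !in_itv/= !andbT ge_max; first by move=> [-> ->].
  by move=> /andP[].
- by move=> n; eexists.
- rewrite -subTset => x _.
  have [n xn] : exists n, `|x| < n%:R.
    by exists (Num.truncn `|x|).+1; rewrite truncnS_gt.
  exists n => //=; rewrite in_itv/= andbT.
  by move: xn => /ltW; rewrite ler_norml => /andP[].
- move=> _ [x ->]; have [x0|x0] := ltP 0 x; first exact: m12.
  by rewrite !m_ray.
- by move=> n; rewrite (le_lt_trans _ m1oo)// le_measure ?inE.
- exact: mA.
Qed.

(** Integrating [f] over a set defines a measure, which is compared with the law of [X]; finiteness
    comes from the law, a probability. *)
Lemma has_density_positive_rays (R : realType) (d : measure_display)
    (T : measurableType d) (P : probability T R) (X : {RV P >-> R}) (f : R -> R) :
  measurable_fun setT f -> (forall t, 0 <= f t) ->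
  (forall t, t <= 0 -> f t = 0) ->
  distribution P X `]-oo, 0]%classic = 0%E ->
  (forall x : R, 0 < x -> distribution P X `[x, +oo[%classic =
    (\int[lebesgue_measure]_(t in `[x, +oo[) (f t)%:E)%E) ->
  has_density X f.
Proof.
move=> mf f_ge0 f0 X0 Xf; split=> //.
pose nu (A : set R) := (\int[lebesgue_measure]_(t in A) (f t)%:E)%E.
have nu0 : nu set0 = 0%E by rewrite /nu integral_set0.
have nu_ge0 A : (0 <= nu A)%E by apply: integral_ge0 => t _; rewrite lee_fin.
have nu_additive : semi_sigma_additive nu.
  move=> F mF tF mUF; rewrite /nu; apply: cvg_toP.
    apply: ereal_nondecreasing_is_cvgn => m n mn.
    by apply: lee_sum_nneg_natr => // k _ _; exact: nu_ge0.
  rewrite ge0_integral_bigcup//=.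
  - by apply/measurable_funTS/measurable_EFinP.
  - by move=> t _; rewrite lee_fin.
pose nuM := isMeasure.Build _ _ _ nu nu0 nu_ge0 nu_additive.
pose m : {measure set R -> \bar R} := HB.pack nu nuM.
apply: (@measure_unique_positive_rays R (distribution P X) m) => //.
- rewrite /m/= /nu integral0_eq// => t /=; rewrite in_itv/= => t0.
  by rewrite f0.
- have : (P setT < +oo)%E by rewrite probability_setT ltry.
  exact.
Qed.

(** * Maxima of exponential variables: monotonicity of the density ratio *)

(* For u > 0, the density of the maximum of independent exponential variables
   with rates a and b. *)
Definition max_exp_pdf {R : realType} (a b u : R) : R :=
  a * expR (- (a * u)) * (1 - expR (- (b * u))) +
  (1 - expR (- (a * u))) * (b * expR (- (b * u))).

(* The integral of [expR (a * s)] over [0, u]. *)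
Definition expint {R : realType} (a u : R) : R := (expR (a * u) - 1) / a.

(** Each factor [1 - expR (- (k * u))] equals [k * expR (- (k * u)) * expint k u]. *)
Lemma max_exp_pdfE {R : realType} (a b u : R) : 0 < a -> 0 < b ->
  max_exp_pdf a b u =
  a * b * expR (- ((a + b) * u)) * (expint a u + expint b u).
Proof.
move=> a0 b0; rewrite /max_exp_pdf /expint.
rewrite (mulrDl a b u) !expRN expRD.
have := expR_gt0 (a * u); have := expR_gt0 (b * u).
move: (expR _) (expR _) => x y x0 y0.
by field; rewrite !gt_eqF.
Qed.

Lemma expint_gt0 {R : realType} (a u : R) : 0 < a -> 0 < u -> 0 < expint a u.
Proof. by move=> a0 u0; rewrite divr_gt0// subr_gt0 expR_gt1 mulr_gt0. Qed.

Lemma is_derive_expint {R : realType} (a u : R) : a != 0 ->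
  is_derive u 1 (expint a) (expR (a * u)).
Proof.
move=> a0; rewrite /expint.
apply: is_derive_eq.
by rewrite /GRing.scale/= mulr0 add0r mulr1 subr0; field.
Qed.

Lemma ge0_is_derive_le {R : realType} (f df : R -> R) (u v : R) : u <= v ->
  (forall x : R, u <= x -> is_derive x 1 f (df x)) ->
  (forall x : R, u <= x -> 0 <= df x) -> f u <= f v.
Proof.
move=> uv fdf df0.
apply: (@ger0_derive1_ndecr _ f u v) => //.
- by move=> x; rewrite in_itv/= => /andP[/ltW ux _]; case: (fdf x ux).
- move=> x; rewrite in_itv/= => /andP[/ltW ux _].
  by rewrite derive1E; case: (fdf x ux) => _ ->; exact: df0.
- apply: derivable_within_continuous => x; rewrite in_itv/= => /andP[ux _].
  by case: (fdf x ux).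
Qed.

(* Both sides are integrals over [0, u], of e^(c s) and e^(a s). *)
Lemma le_expint {R : realType} (a c u : R) : 0 < c -> c <= a -> 0 <= u ->
  expint c u <= expint a u.
Proof.
move=> c0 ca u0; have a0 := lt_le_trans c0 ca.
rewrite -subr_ge0.
rewrite [leLHS](_ : 0 = expint a 0 - expint c 0); last first.
  by rewrite /expint !mulr0 expR0 subrr !mul0r subrr.
apply: (@ge0_is_derive_le _ (fun v => expint a v - expint c v)
  (fun v => expR (a * v) - expR (c * v))) => // x x0.
  by apply: is_deriveB; apply: is_derive_expint; rewrite gt_eqF.
by rewrite subr_ge0 ler_expR ler_wpM2r.
Qed.

Lemma max_exp_pdf_ratio_ndecr {R : realType} (a b c u v : R) :
  0 < c -> c <= a -> c <= b -> 0 < u -> u <= v ->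
  max_exp_pdf c b u / max_exp_pdf a b u <=
  max_exp_pdf c b v / max_exp_pdf a b v.
Proof.
move=> c0 ca cb u0 uv.
have [a0 b0] : 0 < a /\ 0 < b by split; exact: lt_le_trans c0 _.
have v0 := lt_le_trans u0 uv.
(* The ratio of densities without its constant factor [c / a]. *)
pose r x := expR ((a - c) * x) * (expint c x + expint b x) /
  (expint a x + expint b x).
have S_gt0 x : 0 < x -> 0 < expint a x + expint b x.
  by move=> x0; rewrite addr_gt0// expint_gt0.
have ratioE x : 0 < x -> max_exp_pdf c b x / max_exp_pdf a b x = c / a * r x.
  move=> x0; rewrite !max_exp_pdfE// /r.
  have -> : expR (- ((c + b) * x)) =
      expR (- ((a + b) * x)) * expR ((a - c) * x).
    by rewrite -expRD; congr expR; ring.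
  have := expR_gt0 (- ((a + b) * x)); have := S_gt0 _ x0.
  move: (expR _) (expR _) (expint _ _) (expint _ _) => e e' sc sb s_gt0 e_gt0.
  by field; rewrite !gt_eqF.
rewrite !ratioE//; apply: ler_wpM2l; first by rewrite divr_ge0// ltW.
(* The quotient rule with [expR (k * x) = k * expint k x + 1] for [k = a, b, c]. The factor [a - c]
   from the exponential is split: [a] cancels the term [a * expint a x] and [c] the term
   [c * expint c x], so that only the differences [b - a] and [b - c] remain. *)
pose dr x := expR ((a - c) * x) *
  ((expint a x + expint b x) * (2 + (b - c) * expint b x) -
   (expint c x + expint b x) * (2 + (b - a) * expint b x)) /
  (expint a x + expint b x) ^+ 2.
apply: (@ge0_is_derive_le _ r dr u v uv) => x ux; have x0 := lt_le_trans u0 ux.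
  have da := @is_derive_expint _ a x (lt0r_neq0 a0).
  have db := @is_derive_expint _ b x (lt0r_neq0 b0).
  have dc := @is_derive_expint _ c x (lt0r_neq0 c0).
  have s_neq0 := lt0r_neq0 (S_gt0 _ x0).
  have dab := is_deriveD da db.
  have ds : is_derive x 1 (fun x => (expint a x + expint b x)^-1)
      (- (expint a x + expint b x) ^- 2 *: (expR (a * x) + expR (b * x))).
    exact: (@is_deriveV _ (expint a + expint b) _ _ _ s_neq0 dab).
  have de : is_derive x 1 (fun x => expR ((a - c) * x))
      ((a - c) * expR ((a - c) * x)).
    by apply: is_derive_eq; rewrite /GRing.scale/=; ring.
  have dr' := is_deriveM (is_deriveM de (is_deriveD dc db)) ds.
  apply: (is_derive_eq dr').
  have expE k : 0 < k -> expR (k * x) = k * expint k x + 1.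
    by move=> k0; rewrite /expint; field; rewrite gt_eqF.
  rewrite /dr /GRing.scale/=.
  rewrite !fctE (expE a)// (expE b)// (expE c)//.
  move: (expint a x) (expint b x) (expint c x) (expR _) s_neq0.
  move=> sa sb sc e s_neq0.
  by field.
have Sca : expint c x <= expint a x by rewrite le_expint// ltW.
have sb := expint_gt0 _ _ b0 x0; have sc := expint_gt0 _ _ c0 x0.
rewrite divr_ge0 ?exprn_ge0 ?(ltW (S_gt0 _ _))// mulr_ge0 ?expR_ge0//.
have : 0 <= (b - c) * expint b x by rewrite mulr_ge0 ?subr_ge0// ltW.
have : (b - a) * expint b x <= (b - c) * expint b x.
  by rewrite ler_wpM2r ?(ltW sb)// lerD2l lerN2.
move: ((b - a) * _) ((b - c) * _) => p q pq q0.
(* The sign of [2 + p] is unknown, as [a] and [b] are not compared. Hence [p] is first raised to [q]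
   against the positive sum with [expint c x]; then [expint c x] is raised to [expint a x] against
   [2 + q >= 0]. *)
rewrite subr_ge0 (@le_trans _ _ ((expint c x + expint b x) * (2 + q)))//.
  by rewrite ler_pM2l ?lerD2l ?addr_gt0.
by rewrite ler_wpM2r ?lerD2r// addr_ge0.
Qed.

(** * Weibull distributions and the density of their maximum *)

(* Meaningful for [0 <= t] only: a negative base has power 1, and for t < 0 this
   is [1 - expR (- 1)]. *)
Definition weibull_cdf {R : realType} (alpha lambda t : R) : R :=
  1 - expR (- (lambda * t) `^ alpha).

(** The derivative of the product of the two distribution functions at [t > 0]. For [t <= 0] both
    values of [weibull_pdf] are 0, which cancels the values of [weibull_cdf] there. *)
Definition weibull_max_pdf {R : realType} (alpha lambda mu t : R) : R :=
  weibull_pdf alpha lambda t * weibull_cdf alpha mu t +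
  weibull_cdf alpha lambda t * weibull_pdf alpha mu t.

Lemma is_derive_powR_scale {R : realType} (lambda a t : R) :
  0 < lambda -> 0 < t ->
  is_derive t 1 (fun s : R => (lambda * s) `^ a)
    (a * lambda * (lambda * t) `^ (a - 1)).
Proof.
move=> l0 t0; have lt0 : 0 < lambda * t by rewrite mulr_gt0.
have dp := @is_derive1_powR _ a _ lt0.
have dl : is_derive t 1 (fun s : R => lambda * s) lambda.
  by apply: is_derive_eq; rewrite /GRing.scale/=; ring.
by apply: (is_derive_eq (@is_derive1_comp _ _ _ _ _ _ dp dl)); ring.
Qed.

Lemma is_derive_weibull_cdf {R : realType} (alpha lambda t : R) :
  0 < lambda -> 0 < t ->
  is_derive t 1 (weibull_cdf alpha lambda) (weibull_pdf alpha lambda t).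
Proof.
move=> l0 t0; have dp := is_derive_powR_scale lambda alpha t l0 t0.
rewrite /weibull_cdf /weibull_pdf t0.
by apply: is_derive_eq; rewrite /GRing.scale/=; ring.
Qed.

Lemma continuous_weibull_pdf {R : realType} (alpha lambda t : R) :
  0 < lambda -> 0 < t -> {for t, continuous (weibull_pdf alpha lambda)}.
Proof.
move=> l0 t0.
have dp := is_derive_powR_scale lambda alpha t l0 t0.
have dp1 := is_derive_powR_scale lambda (alpha - 1) t l0 t0.
(* The positive branch of [weibull_pdf], differentiable at [t] and equal to the density near [t]. *)
pose f (s : R) := alpha * lambda * (lambda * s) `^ (alpha - 1) *
  expR (- (lambda * s) `^ alpha).
have cf : {for t, continuous f}.
  by apply/differentiable_continuous/derivable1_diffP; apply: ex_derive.
rewrite /prop_for /continuous_at /weibull_pdf t0.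
apply: cvg_trans cf; apply: near_eq_cvg; near=> s.
by rewrite ifT//; near: s; exact: lt_nbhsr.
Unshelve. end_near. Qed.

Lemma weibull_cdf_cvg {R : realType} (alpha lambda : R) :
  0 < alpha -> 0 < lambda -> weibull_cdf alpha lambda t @[t --> +oo] --> (1 : R).
Proof.
move=> a0 l0; rewrite -[X in _ --> X]subr0; apply: cvgB; first exact: cvg_cst.
apply: (@cvg_comp _ _ _ (fun t : R => (lambda * t) `^ alpha)
  (fun y => expR (- y)) _ (pinfty_nbhs R)); last exact: cvgr_expR.
apply/cvgryPge => A; near=> t.
have At : lambda^-1 * `|A| `^ alpha^-1 <= t.
  by near: t; exact: nbhs_pinfty_ge (num_real _).
have lAt : `|A| `^ alpha^-1 <= lambda * t by rewrite -ler_pdivrMl.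
rewrite (le_trans (ler_norm A))// -[leLHS]powRr1// -(mulVf (lt0r_neq0 a0)) powRrM.
have lt0 := le_trans (powR_ge0 _ _) lAt.
by rewrite ge0_ler_powR ?nnegrE ?powR_ge0// ltW.
Unshelve. end_near. Qed.

Lemma integral_ray_derive {R : realType} (f F : R -> R) (x l : R) :
  (forall t, x <= t -> 0 <= f t) ->
  (forall t, x <= t -> {for t, continuous f}) ->
  (forall t : R, x <= t -> is_derive t 1 F (f t)) ->
  F t @[t --> +oo] --> l ->
  (\int[lebesgue_measure]_(t in `[x, +oo[) (f t)%:E = (l - F x)%:E)%E.
Proof.
move=> f0 cf dF Fl; rewrite EFinB; apply: ge0_continuous_FTC2y => //.
- apply: continuous_in_subspaceT => t; rewrite inE/= in_itv/= andbT; exact: cf.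
- by move=> t /ltW xt; case: (dF t xt).
- apply: cvg_at_right_filter; apply/differentiable_continuous/derivable1_diffP.
  by case: (dF x (lexx x)).
- move=> t; rewrite in_itv/= andbT => /ltW xt.
  by rewrite derive1E; case: (dF t xt).
Qed.

Lemma weibull_pdf_ge0 {R : realType} (alpha lambda t : R) :
  0 <= alpha -> 0 <= lambda -> 0 <= weibull_pdf alpha lambda t.
Proof.
move=> a0 l0; rewrite /weibull_pdf; case: ifP => // _.
by rewrite !mulr_ge0 ?powR_ge0 ?expR_ge0.
Qed.

Lemma weibull_cdf_ge0 {R : realType} (alpha lambda t : R) :
  0 <= weibull_cdf alpha lambda t.
Proof. by rewrite subr_ge0 -expR0 ler_expR lerNl oppr0 powR_ge0. Qed.

(** The ray is open at [x] so that its complement is the closed ray on which the density is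
    integrated. *)
Lemma weibull_ray {R : realType} (d : measure_display) (T : measurableType d)
    (P : probability T R) (X : {RV P >-> R}) (alpha lambda x : R) :
  0 < alpha -> 0 < lambda -> 0 < x -> weibull X alpha lambda ->
  distribution P X `]-oo, x[%classic = (weibull_cdf alpha lambda x)%:E.
Proof.
move=> a0 l0 x0 [_ _ XE].
have -> : distribution P X `]-oo, x[%classic =
    (1 - distribution P X `[x, +oo[%classic)%E.
  by rewrite -setCitvr; exact: probability_setC.
rewrite XE//.
have -> : (\int[lebesgue_measure]_(t in `[x, +oo[)
    (weibull_pdf alpha lambda t)%:E = (1 - weibull_cdf alpha lambda x)%:E)%E.
  apply: integral_ray_derive.
  - by move=> t _; rewrite weibull_pdf_ge0 ?ltW.
  - by move=> t xt; apply: continuous_weibull_pdf => //; exact: lt_le_trans xt.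
  - by move=> t xt; apply: is_derive_weibull_cdf => //; exact: lt_le_trans xt.
  - exact: weibull_cdf_cvg.
by rewrite -EFinB opprB addrC subrK.
Qed.

(** For [x > 0] the maximum is below [x] exactly when both variables are, so independence makes its
    distribution function the product of theirs; the survival function is then the integral of the
    derivative of that product. *)
Lemma has_density_weibull_max {R : realType} (d : measure_display)
    (T : measurableType d) (P : probability T R) (X Y : {RV P >-> R})
    (alpha lambda mu : R) :
  0 < alpha -> 0 < lambda -> 0 < mu -> indep_RV X Y ->
  weibull X alpha lambda -> weibull Y alpha mu ->
  has_density (X \max Y : {RV P >-> R}) (weibull_max_pdf alpha lambda mu).
Proof.
move=> a0 l0 m0 XY wX wY.
have pdf0 (k t : R) : t <= 0 -> weibull_pdf alpha k t = 0.
  by rewrite /weibull_pdf leNgt => /negbTE ->.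
have mcdf (k : R) : measurable_fun setT (weibull_cdf alpha k).
  apply: measurable_funB => //; apply: measurableT_comp => //.
  apply: measurable_funN; apply: (measurableT_comp (measurable_powR _)).
  exact: measurable_funM.
have pdf_ge0 t : 0 <= weibull_max_pdf alpha lambda mu t.
  by rewrite addr_ge0// mulr_ge0 ?weibull_pdf_ge0 ?weibull_cdf_ge0// ltW.
apply: has_density_positive_rays => //.
- by apply: measurable_funD; apply: measurable_funM => //;
    [case: wX|case: wY].
- by move=> t t0; rewrite /weibull_max_pdf !pdf0// mul0r mulr0 addr0.
(* A nonpositive maximum forces [X <= 0], a null event since the density of [X] vanishes there. *)
- apply: (@subset_measure0 _ _ _ P _ (X @^-1` `]-oo, 0])) => //.
  + by rewrite -[X in measurable X]setTI; exact: measurable_funP.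
  + by rewrite -[X in measurable X]setTI; exact: measurable_funP.
  + by move=> w /=; rewrite !in_itv/= ge_max => /andP[].
  + case: wX => _ _ XE; rewrite -[LHS]/(distribution P X _) XE//.
    by rewrite integral0_eq// => t; rewrite /= in_itv/= => t0; rewrite pdf0.
move=> x x0.
have -> : distribution P (X \max Y : {RV P >-> R}) `[x, +oo[%classic =
    (1 - distribution P (X \max Y : {RV P >-> R}) `]-oo, x[%classic)%E.
  by rewrite -setCitvl; exact: probability_setC.
have -> : distribution P (X \max Y : {RV P >-> R}) `]-oo, x[%classic =
    (weibull_cdf alpha lambda x * weibull_cdf alpha mu x)%:E.
  rewrite EFinM; have <- := weibull_ray _ _ _ _ _ _ _ a0 l0 x0 wX.
  have <- := weibull_ray _ _ _ _ _ _ _ a0 m0 x0 wY.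
  rewrite /distribution /pushforward -XY//; congr (P _).
  by apply/seteqP; split => w /=; rewrite !in_itv/= gt_max => /andP.
have gt0 t : x <= t -> 0 < t by exact: lt_le_trans.
apply/esym; apply: (@integral_ray_derive _ (weibull_max_pdf alpha lambda mu)
  (weibull_cdf alpha lambda * weibull_cdf alpha mu) x 1) => //.
- move=> t /gt0 t0.
  have cX := continuous_weibull_pdf alpha lambda t l0 t0.
  have cY := continuous_weibull_pdf alpha mu t m0 t0.
  have cdf_cont k : 0 < k -> {for t, continuous (weibull_cdf alpha k)}.
    move=> k0; apply/differentiable_continuous/derivable1_diffP.
    by case: (is_derive_weibull_cdf alpha k t k0 t0).
  exact: (continuousD (continuousM cX (cdf_cont _ m0))
    (continuousM (cdf_cont _ l0) cY)).
- move=> t /gt0 t0.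
  have dX := is_derive_weibull_cdf alpha lambda t l0 t0.
  have dY := is_derive_weibull_cdf alpha mu t m0 t0.
  apply: (is_derive_eq (is_deriveM dX dY)).
  by rewrite /weibull_max_pdf /GRing.scale/= addrC [X in X + _]mulrC.
- by rewrite -[X in _ --> X]mulr1; apply: cvgM; exact: weibull_cdf_cvg.
Qed.

(** * Reduction of the Weibull case to the exponential one *)

Lemma weibull_max_pdfE {R : realType} (alpha lambda mu t : R) :
  0 < lambda -> 0 < mu -> 0 < t ->
  weibull_max_pdf alpha lambda mu t =
  alpha * t `^ (alpha - 1) *
  max_exp_pdf (lambda `^ alpha) (mu `^ alpha) (t `^ alpha).
Proof.
move=> l0 m0 t0; rewrite /weibull_max_pdf /weibull_pdf /weibull_cdf t0.
have powE k : 0 < k -> k * k `^ (alpha - 1) = k `^ alpha.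
  move=> k0; rewrite -[X in X * _]powRr1 ?ltW// -powRD; last first.
    by rewrite (lt0r_neq0 k0) implybT.
  by congr (_ `^ _); ring.
rewrite !powRM ?ltW// /max_exp_pdf -(powE lambda)// -(powE mu)//; ring.
Qed.

Lemma max_exp_pdf_gt0 {R : realType} (a b u : R) :
  0 < a -> 0 < b -> 0 < u -> 0 < max_exp_pdf a b u.
Proof.
move=> a0 b0 u0; rewrite max_exp_pdfE// !mulr_gt0 ?expR_gt0//.
by rewrite addr_gt0// expint_gt0.
Qed.

Theorem theorem4p9 (R : realType)
    (d : measure_display) (T : measurableType d) (P : probability T R)
    (d' : measure_display) (T' : measurableType d') (Q : probability T' R)
    (alpha lambda1 lambda lambda1s : R)
    (alpha_gt0 : 0 < alpha) (lambda1_gt0 : 0 < lambda1)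
    (lambda_gt0 : 0 < lambda) (lambda1s_gt0 : 0 < lambda1s)
    (X1 X2 : {RV P >-> R}) (Y1 Y2 : {RV Q >-> R})
    (X_indep : indep_RV X1 X2)
    (X1_weibull : weibull X1 alpha lambda1)
    (X2_weibull : weibull X2 alpha lambda)
    (Y_indep : indep_RV Y1 Y2)
    (Y1_weibull : weibull Y1 alpha lambda1s)
    (Y2_weibull : weibull Y2 alpha lambda)
    (lambda1s_min : lambda1s = Num.min lambda (Num.min lambda1 lambda1s)) :
  weak_maj [tuple lambda1; lambda] [tuple lambda1s; lambda] ->
  lr_le (X1 \max X2 : {RV P >-> R}) (Y1 \max Y2 : {RV Q >-> R}).
Proof.
move=> _.
have le_lambda : lambda1s <= lambda by rewrite lambda1s_min ge_min lexx.
have le_lambda1 : lambda1s <= lambda1.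
  by rewrite lambda1s_min !ge_min lexx orbT.
exists (weibull_max_pdf alpha lambda1 lambda).
exists (weibull_max_pdf alpha lambda1s lambda).
split; [exact: has_density_weibull_max|exact: has_density_weibull_max|].
(* Both densities vanish for [t <= 0], so the ratio is compared at positive points only. *)
have supp t : t \in [pred t | (weibull_max_pdf alpha lambda1 lambda t != 0) ||
    (weibull_max_pdf alpha lambda1s lambda t != 0)] -> 0 < t.
  rewrite inE; apply: contraLR => /negbTE t0.
  by rewrite /weibull_max_pdf /weibull_pdf t0 !mul0r !mulr0 !addr0 eqxx.
move=> s t /supp s0 /supp t0 st.
have ratioE r : 0 < r ->
    ((weibull_max_pdf alpha lambda1s lambda r)%:E /
     (weibull_max_pdf alpha lambda1 lambda r)%:E)%E =
    (max_exp_pdf (lambda1s `^ alpha) (lambda `^ alpha) (r `^ alpha) /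
     max_exp_pdf (lambda1 `^ alpha) (lambda `^ alpha) (r `^ alpha))%:E.
  move=> r0.
  have den_gt0 :
      0 < max_exp_pdf (lambda1 `^ alpha) (lambda `^ alpha) (r `^ alpha).
    by rewrite max_exp_pdf_gt0 ?powR_gt0.
  have c_gt0 : 0 < alpha * r `^ (alpha - 1) by rewrite mulr_gt0// powR_gt0.
  rewrite !weibull_max_pdfE// inver gt_eqF ?(mulr_gt0 c_gt0 den_gt0)//.
  rewrite -EFinM; congr EFin.
  by rewrite -mulf_div divff ?mul1r// gt_eqF.
(* This carries the order of the parameters over to the rates, and that of [s] and [t] to the new
   variable. *)
have powR_le x y : 0 < x -> x <= y -> x `^ alpha <= y `^ alpha.
  move=> x0 xy; have y0 := lt_le_trans x0 xy.
  by apply: ge0_ler_powR => //; rewrite ?nnegrE ltW.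
rewrite (ratioE s s0) (ratioE t t0) lee_fin.
by apply: max_exp_pdf_ratio_ndecr; (exact: powR_gt0 || exact: powR_le).
Qed.
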